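(* Let $n\ge 4$. Consider the board obtained from the $C_n$ board (a cycle graph with $n$ vertices embedded in the plane) by adding one internal chord connecting two non-adjacent vertices of the cycle, so that the board has two bounded cells. In the Game of Cycles on this board, if $n$ is even then Player~1 has a winning strategy, and if $n$ is odd then Player~2 has a winning strategy.
   Context: The Game of Cycles. A board is a simple connected planar graph embedded in the plane, together with its bounded cells. Two players alternate turns; on a turn a player marks one unmarked edge with an arrow pointing along the edge in one of its two directions. Each edge receives at most one arrow, and arrows have the same effect regardless of who placed them. Moves must obey the sink-source rule: no move may create a sink (a vertex all of whose incident edges are marked with arrows pointing toward it) or a source (a vertex all of whose incident edges are marked with arrows pointing away from it). A player who has a legal move must make one. A cycle cell is a bounded cell all of whose boundary edges are marked with arrows all cycling in the same direction around that cell. The first player to create a cycle cell wins; if play ends (no legal move remains) without a cycle cell, the player who made the last move wins. A winning strategy guarantees a win regardless of the opponent's moves. *)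

(* Defs.v *)
From mathcomp Require Import all_boot.
Set Implicit Arguments. Unset Strict Implicit. Unset Printing Implicit Defensive.

Section Game.
(* A board: vertex type V, edge type E, each edge e joins (ends e).1 and
   (ends e).2; bounded cells are given by their boundary edges, each paired
   with the direction in which a fixed rotational traversal of the cell
   boundary crosses the edge (true = from (ends e).1 to (ends e).2). *)
Variables (V E : finType) (ends : E -> V * V) (cells : seq (seq (E * bool))).

(* A marking: m e = None (unmarked) or Some d; the arrow Some true points
   from (ends e).1 to (ends e).2, Some false points the other way. *)
Definition marking := {ffun E -> option bool}.

Definition arrow_head (e : E) (d : bool) : V := if d then (ends e).2 else (ends e).1.
Definition arrow_tail (e : E) (d : bool) : V := if d then (ends e).1 else (ends e).2.
Definition incident (v : V) (e : E) : bool := ((ends e).1 == v) || ((ends e).2 == v).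

Definition is_sink (m : marking) (v : V) : bool :=
  [forall e, incident v e ==> (if m e is Some d then arrow_head e d == v else false)].
Definition is_source (m : marking) (v : V) : bool :=
  [forall e, incident v e ==> (if m e is Some d then arrow_tail e d == v else false)].

Definition mark (m : marking) (e : E) (d : bool) : marking :=
  [ffun x => if x == e then Some d else m x].

Definition legal_move (m : marking) (e : E) (d : bool) : bool :=
  (m e == None) &&
  [forall v, (is_sink (mark m e d) v ==> is_sink m v) &&
             (is_source (mark m e d) v ==> is_source m v)].

Definition has_move (m : marking) : bool := [exists e, exists d, legal_move m e d].

Definition cycle_cell (m : marking) (c : seq (E * bool)) : bool :=
  all (fun p => m p.1 == Some p.2) c || all (fun p => m p.1 == Some (~~ p.2)) c.

Definition has_cycle_cell (m : marking) : bool := has (cycle_cell m) cells.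

(* wins m : the player to move at position m has a winning strategy;
   loses m : the player to move at m has a legal move, and the opponent has
   a winning strategy. *)
Inductive wins : marking -> Prop :=
| WinMove (m : marking) (e : E) (d : bool) :
    legal_move m e d ->
    (has_cycle_cell (mark m e d) \/ ~~ has_move (mark m e d) \/ loses (mark m e d)) ->
    wins m
with loses : marking -> Prop :=
| LoseAll (m : marking) :
    has_move m ->
    (forall e d, legal_move m e d ->
       [/\ ~~ has_cycle_cell (mark m e d), has_move (mark m e d) & wins (mark m e d)]) ->
    loses m.

Definition empty_marking : marking := [ffun => None].

Definition player1_wins : Prop := wins empty_marking.
Definition player2_wins : Prop := loses empty_marking.
End Game.

(* The C_n board with a chord between vertices a < b.  Edge [Some k] is the
   cycle edge {k, k+1 mod n}; edge [None] is the chord {a, b}. *)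
Definition chord_ends (n : nat) (a b : 'I_n) (e : option 'I_n) : 'I_n * 'I_n :=
  match e with Some k => (k, ordS k) | None => (a, b) end.

(* Cell 1: a -> a+1 -> ... -> b along the cycle, then back b -> a by the chord.
   Cell 2: b -> b+1 -> ... -> n-1 -> 0 -> ... -> a, then a -> b by the chord. *)
Definition chord_cells (n : nat) (a b : 'I_n) : seq (seq (option 'I_n * bool)) :=
  [:: rcons [seq (Some k, true) | k : 'I_n <- enum 'I_n & (a <= k < b)] (None, false);
      rcons [seq (Some k, true) | k : 'I_n <- enum 'I_n & ~~ (a <= k < b)] (None, true)].

(* Main.v *)
Require Import Defs.
From mathcomp Require Import all_boot.
From mathcomp Require Import zify.
Set Implicit Arguments. Unset Strict Implicit. Unset Printing Implicit Defensive.

(** Let W be the player who would move last if every edge got marked. W wants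
    the chord marked early; then read each arrow on the cycle as running along
    the chord (from its tail to its head) or against it. A cell is completed by
    arrows all against the chord, and at each end of the chord the two cycle
    edges may not both run along it. Once each end of the chord carries an arrow
    running along it, marked neighbours turn the same way around the cycle, so a
    stuck position has an even number of unmarked edges. By this parity W never
    runs out of moves, and never has to leave a cell with a single gap.

    W secures the two ends one after the other with arrows along the chord. An
    opponent's move can endanger both ends only if it is an arrow against the
    chord on an arc of length 2, which W completes, or in the middle of an arc
    of length 3. In that last case W plays by reflection on the other arc, and
    the opponent must finally enter the short arc, which W then completes. *)

(** * The board *)

Lemma val_ordS n (k : 'I_n) : ordS k = (if k.+1 == n then 0 else k.+1) :> nat.
Proof.
rewrite /=; case: eqP => [->|/eqP ne]; first by rewrite modnn.
by rewrite modn_small // ltn_neqAle ne ltn_ord.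
Qed.

Section ChordBoard.

Variables (n : nat) (a b : 'I_n).
Hypotheses (n_ge4 : 4 <= n) (ltab : a.+1 < b)
  (nonadj : ~~ ((nat_of_ord a == 0) && (nat_of_ord b == n.-1))).

Local Notation s := (@ordS n).
Local Notation p := (@ord_pred n).
Local Notation ends := (chord_ends a b).
Local Notation cells := (chord_cells a b).
Local Notation position := (marking (option 'I_n)).

Lemma ord_eqE (x y : 'I_n) : (x == y) = (x == y :> nat).
Proof. by []. Qed.

Lemma ordS_neq (k : 'I_n) : s k != k.
Proof. by rewrite ord_eqE val_ordS; case: ifP; lia. Qed.

Lemma ord_pred_neq (k : 'I_n) : p k != k.
Proof. by rewrite -{2}(ord_predK k) eq_sym ordS_neq. Qed.

(* Direction of the cycle edge [k] that runs from the tail to the head of the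
   chord, when the chord carries the arrow [d]. *)
Definition along (d : bool) (k : 'I_n) : bool := (a <= k < b) == d.

(* The vertex between the cycle edges [k] and [s k] is an end of the chord. *)
Definition joint (k : 'I_n) : bool := (s k == a) || (s k == b).

Lemma along_succ d k : along d (s k) = along d k (+) joint k.
Proof.
have := ltn_ord k; have := ltn_ord b.
rewrite /along /joint !ord_eqE !val_ordS; case: d; case: ifP => /=; lia.
Qed.

Lemma along_joint d j : joint j -> along d (s j) = ~~ along d j.
Proof. by rewrite along_succ => ->; rewrite addbT. Qed.

Lemma along_nonjoint d k : ~~ joint k -> along d (s k) = along d k.
Proof. by rewrite along_succ => /negbTE ->; rewrite addbF. Qed.

Lemma joint_succ j : joint j -> ~~ joint (s j).
Proof.
have := ltn_ord j; have := ltn_ord b; move: nonadj.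
by rewrite /joint !ord_eqE !val_ordS; do 2! case: ifP; lia.
Qed.

Lemma joint_pred j : joint j -> ~~ joint (p j).
Proof. by apply: contraL => /joint_succ; rewrite ord_predK. Qed.

(** There are only two joints, so the arc that starts after one of them ends at the other. *)
Lemma joint_other d j j' : joint j -> joint j' -> j != j' ->
  along d (s j) = along d j'.
Proof.
move=> Jj Jj' ne.
have : s j != s j' by rewrite (inj_eq (@ordS_inj n)).
rewrite -[along d j']negbK -along_joint //.
case/orP: Jj => /eqP ->; case/orP: Jj' => /eqP ->; rewrite ?eqxx // => _;
  rewrite /along; case: d; lia.
Qed.

Lemma joint_pa : joint (p a).
Proof. by rewrite /joint ord_predK eqxx. Qed.

Lemma joint_pb : joint (p b).
Proof. by rewrite /joint ord_predK eqxx orbT. Qed.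

(** Non-adjacent chord ends give each cell at least two cycle edges. Hence an untouched cell cannot
    be completed in one move. *)
Lemma cell_two d z : exists k, along d k = z /\ along d (s k) = z.
Proof.
have [<-|ne] := eqVneq (along d a) z.
  exists a; split=> //; rewrite along_nonjoint // -(ord_predK a).
  exact: joint_succ joint_pa.
have e : along d b = z by move: ne; rewrite /along; case: d; case: z; lia.
exists b; split=> //; rewrite along_nonjoint // -(ord_predK b).
exact: joint_succ joint_pb.
Qed.

Lemma arc2 d j k : joint j -> joint (s (s j)) -> along d k = along d (s j) ->
  k \in [:: s j; s (s j)].
Proof.
have lk := ltn_ord k; have lb := ltn_ord b; have lj := ltn_ord j.
rewrite !inE /joint /along !ord_eqE !val_ordS => /orP[] /eqP->;
  case: d; do 2! case: ifP; lia.
Qed.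

Lemma arc3 d j k : joint j -> joint (s (s (s j))) -> along d k = along d (s j) ->
  k \in [:: s j; s (s j); s (s (s j))].
Proof.
have lk := ltn_ord k; have lb := ltn_ord b; have lj := ltn_ord j.
rewrite !inE /joint /along !ord_eqE !val_ordS => /orP[] /eqP->;
  case: d; do 3! case: ifP; lia.
Qed.


(** With four edges the other arc would have length 1, putting two joints next to each other. *)
Lemma arc3_gt4 j : joint j -> joint (s (s (s j))) -> 4 < n.
Proof.
have ordS4 (i : 'I_4) : ordS (ordS (ordS (ordS i))) = i.
  by apply/eqP; case: i => -[|[|[|[|]]]].
move=> Jj J3; rewrite ltn_neqAle n_ge4 andbT; apply/eqP => n4.
suff e : s (s (s (s j))) = j by have := joint_succ J3; rewrite e Jj.
by move: (j); rewrite -n4.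
Qed.
(** * Positions with a marked chord *)

Section ChordMarked.

Variable d : bool.
Implicit Types (m : position) (j k l : 'I_n) (c x z : bool).

Local Notation al := (along d).

(* Colour of a cycle edge: [Some true] for an arrow along the chord, [Some false] for one against it. *)
Definition rel (m : position) (k : 'I_n) : option bool :=
  omap (fun x => x == al k) (m (Some k)).

Definition rmark (m : position) (k : 'I_n) (c : bool) : position :=
  mark m (Some k) (c == al k).

(** The sink-source rule in colours. A vertex of degree 2 must be passed straight through. At a
    chord end the chord already excludes one of sink and source, and the other arises exactly when
    both cycle edges run along the chord. *)
Definition pair_ok (j : bool) (x y : option bool) : bool :=
  match x, y with
  | Some x, Some y => if j then ~~ (x && y) else x == y
  | _, _ => true
  end.

Definition valid (m : position) : Prop :=
  m None = Some d /\ forall k, pair_ok (joint k) (rel m k) (rel m (s k)).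

Lemma rel_mark m k c l :
  rel (rmark m k c) l = if l == k then Some c else rel m l.
Proof.
rewrite /rel ffunE (inj_eq Some_inj); case: eqP => [->|//] /=.
by congr Some; case: c (al k) => [] [].
Qed.

Lemma rmarkN m k c : rmark m k c None = m None.
Proof. by rewrite ffunE. Qed.

Lemma mark_rmark m k x : mark m (Some k) x = rmark m k (x == al k).
Proof. by congr mark; case: x (al k) => [] []. Qed.

Lemma rel_None m k : (rel m k == None) = (m (Some k) == None).
Proof. by rewrite /rel; case: (m _). Qed.

(** The last two conjuncts say that the chord, if it ends at this vertex, points into it. *)
Lemma is_sinkE m k : m None = Some d ->
  is_sink ends m (s k) = [&& m (Some k) == Some true, m (Some (s k)) == Some false,
    (s k == a) ==> ~~ d & (s k == b) ==> d].
Proof.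
move=> md; have /negbTE nk := ordS_neq k; have /negbTE nsk := ordS_neq (s k).
have ab : (a == b) = false by rewrite ord_eqE; lia.
apply/forallP/and4P => [H|[/eqP mk /eqP msk ha hb] [l|]]; rewrite /incident /=.
- move: (H (Some k)) (H (Some (s k))) (H None) => {H}.
  rewrite /incident /arrow_head /= !eqxx orbT md /=.
  rewrite ![a == s k]eq_sym ![b == s k]eq_sym => Hk Hs Hc; split.
  + by move: Hk; case: (m _) => [[]|] //; rewrite eq_sym nk.
  + by move: Hs; case: (m _) => [[]|] //; rewrite nsk.
  + by apply/implyP => sa; move: Hc; rewrite sa /=; case: (d) => //;
      rewrite (eqP sa) eq_sym ab.
  + by apply/implyP => sb; move: Hc; rewrite sb orbT /=; case: (d) => //;
      rewrite (eqP sb) ab.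
- apply/implyP => /orP[/eqP->|/eqP/ordS_inj->]; rewrite ?mk ?msk /=; exact: eqxx.
- rewrite md /arrow_head /=; apply/implyP => /orP[] /eqP e; move: ha hb; rewrite -e.
  + by rewrite eqxx ab /=; case: (d) => //; rewrite eqxx.
  + by rewrite eqxx eq_sym ab /=; case: (d).
Qed.

Lemma is_sourceE m k : m None = Some d ->
  is_source ends m (s k) = [&& m (Some k) == Some false, m (Some (s k)) == Some true,
    (s k == a) ==> d & (s k == b) ==> ~~ d].
Proof.
move=> md; have /negbTE nk := ordS_neq k; have /negbTE nsk := ordS_neq (s k).
have ab : (a == b) = false by rewrite ord_eqE; lia.
apply/forallP/and4P => [H|[/eqP mk /eqP msk ha hb] [l|]]; rewrite /incident /=.
- move: (H (Some k)) (H (Some (s k))) (H None) => {H}.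
  rewrite /incident /arrow_tail /= !eqxx orbT md /=.
  rewrite ![a == s k]eq_sym ![b == s k]eq_sym => Hk Hs Hc; split.
  + by move: Hk; case: (m _) => [[]|] //; rewrite eq_sym nk.
  + by move: Hs; case: (m _) => [[]|] //; rewrite nsk.
  + by apply/implyP => sa; move: Hc; rewrite sa /=; case: (d) => //;
      rewrite (eqP sa) eq_sym ab.
  + by apply/implyP => sb; move: Hc; rewrite sb orbT /=; case: (d) => //;
      rewrite (eqP sb) ab.
- apply/implyP => /orP[/eqP->|/eqP/ordS_inj->]; rewrite ?mk ?msk /=; exact: eqxx.
- rewrite md /arrow_tail /=; apply/implyP => /orP[] /eqP e; move: ha hb; rewrite -e.
  + by rewrite eqxx ab /=; case: (d) => //; rewrite eqxx.
  + by rewrite eqxx eq_sym ab /=; case: (d).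
Qed.

Lemma pair_okE m k : m None = Some d ->
  pair_ok (joint k) (rel m k) (rel m (s k)) =
  ~~ is_sink ends m (s k) && ~~ is_source ends m (s k).
Proof.
move=> md; rewrite is_sinkE // is_sourceE // /rel along_succ /along /joint.
have [lk lb] : k < n /\ b < n by split.
have ha : (s k == a) ==> ~~ (a <= k < b) by rewrite ord_eqE val_ordS; case: ifP; lia.
have hb : (s k == b) ==> (a <= k < b) by rewrite ord_eqE val_ordS; case: ifP; lia.
move: ha hb; case: (s k == a); case: (s k == b); case: (a <= k < b) => //=;
  by case: (m (Some k)) => [[]|]; case: (m (Some (s k))) => [[]|] //=; case: (d).
Qed.

Lemma validP m : m None = Some d ->
  (forall v, ~~ is_sink ends m v && ~~ is_source ends m v) <-> valid m.
Proof.
move=> md; split=> [H|[_ H] v]; first by split=> // k; rewrite pair_okE.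
by rewrite -(ord_predK v) -pair_okE.
Qed.

Lemma valid_legal m e x : m e = None -> valid (mark m e x) -> legal_move ends m e x.
Proof.
move=> me /[dup] -[md _] /(validP md) H; rewrite /legal_move me /=.
by apply/forallP => v; case/andP: (H v) => /negbTE-> /negbTE->.
Qed.

(** Legality only forbids new sinks and sources; a valid position has none, so the next one has none
    either. *)
Lemma legal_valid m e x : valid m -> legal_move ends m e x ->
  exists k c, [/\ mark m e x = rmark m k c, rel m k = None & valid (rmark m k c)].
Proof.
move=> /[dup] -[md _] /(validP md) H /andP[/eqP me /forallP L].
case: e me L => [k|] me L; last by rewrite md in me.
exists k, (x == al k); rewrite -mark_rmark; split=> //; first by rewrite /rel me.
apply/validP; first by rewrite ffunE.
move=> v; case/andP: (H v) => /negbTE Hs /negbTE Ho.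
by move: (L v); rewrite Hs Ho !implybF.
Qed.

Lemma rmark_legal m k c : rel m k = None -> valid (rmark m k c) ->
  legal_move ends m (Some k) (c == al k).
Proof. by move=> rk; apply: valid_legal; apply/eqP; rewrite -rel_None rk. Qed.

Lemma valid_rmark m k c : valid m ->
  pair_ok (joint (p k)) (rel m (p k)) (Some c) ->
  pair_ok (joint k) (Some c) (rel m (s k)) -> valid (rmark m k c).
Proof.
move=> [md V] H1 H2; split=> [|l]; rewrite ?rmarkN // !rel_mark.
have [->|nlk] := eqVneq l k; first by rewrite (negbTE (ordS_neq k)).
have [e|_] := eqVneq (s l) k; last exact: V.
by move: H1; rewrite -e ordSK.
Qed.

Lemma valid_unmark m k c : valid m -> valid (rmark m k c) ->
  pair_ok (joint (p k)) (rel m (p k)) (Some c) /\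
  pair_ok (joint k) (Some c) (rel m (s k)).
Proof.
move=> [md V] [_ V']; move: (V' k) (V' (p k)).
by rewrite ord_predK !rel_mark eqxx (negbTE (ordS_neq k)) (negbTE (ord_pred_neq k)).
Qed.

(** * Cells, their gaps, and safe positions *)

Definition full z m := forall k, al k = z -> rel m k = Some false.

(** A directed cycle through the chord has to return from its head to its tail, so all its other
    arrows run against the chord. *)
Lemma cycle_cellP m : m None = Some d ->
  reflect (exists z, full z m) (has_cycle_cell cells m).
Proof.
move=> md; rewrite /has_cycle_cell /= /cycle_cell !all_rcons !all_map /= md !orbF.
have E (P : pred 'I_n) c :
   reflect (forall k : 'I_n, P k -> m (Some k) = Some c)
     (all (fun k => m (Some k) == Some c) [seq k <- enum 'I_n | P k]).
  apply: (iffP allP) => H k.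
    by move=> Pk; apply/eqP/H; rewrite mem_filter Pk mem_enum.
  by rewrite mem_filter => /andP[Pk _]; apply/eqP/H.
apply: (iffP idP) => [|[z H]].
  case/orP; case/orP => /andP[/eqP[ed] /E H].
  - by exists false => k; rewrite /along /rel ed; case e: (a <= k < b) => // _;
      rewrite H //= /along e.
  - by exists true => k; rewrite /along /rel ed; case e: (a <= k < b) => // _;
      rewrite H //= /along e.
  - by exists false => k; rewrite /along /rel ed; case e: (a <= k < b) => // _;
      rewrite H ?e //= /along e.
  - by exists true => k; rewrite /along /rel ed; case e: (a <= k < b) => // _;
      rewrite H ?e //= /along e.
have {}H k : (a <= k < b) = (z == d) -> m (Some k) = Some (~~ z).
  move=> e; have ak : al k = z by rewrite /along e; case: (z) (d) => [] [].
  by have := H k ak; rewrite /rel ak; case: (m _) => [x|] //=; case: x (z) => [] [].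
have toE (P : pred 'I_n) : (forall k, P k -> (a <= k < b) = (z == d)) ->
    all (fun k => m (Some k) == Some (~~ z)) [seq k <- enum 'I_n | P k].
  by move=> HP; apply/E => k /HP/H.
case: (z) (d) toE => [] [] /= toE; rewrite ?toE ?orbT // => k; exact/negbTE.
Qed.

Definition alive z m := [forall k, (al k == z) ==> (rel m k != Some true)].
Definition miss z m := #|[pred k | (al k == z) && (rel m k == None)]|.
(** The bound also admits a completed cell; [near_wins] excludes that case by its own hypothesis. *)
Definition near z m := alive z m && (miss z m <= 1).
Definition free m := #|[pred k | rel m k == None]|.
Definition safe m := forall z, ~~ near z m.

Lemma free_miss z m : free m = miss z m + miss (~~ z) m.
Proof.
rewrite /free -(cardID [pred k | al k == z]); congr (_ + _); apply: eq_card => k.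
  by rewrite !inE andbC.
by rewrite !inE; case: (al k) (z) => [] [].
Qed.

Lemma miss_rmark z m k c : rel m k = None ->
  miss z m = (al k == z) + miss z (rmark m k c).
Proof.
move=> rk; rewrite /miss (cardD1 k) !inE rk eqxx andbT; congr (_ + _).
apply: eq_card => l; rewrite !inE rel_mark; case: (l == k) => //=.
by rewrite andbF.
Qed.

Lemma free_rmark m k c : rel m k = None -> free m = (free (rmark m k c)).+1.
Proof.
move=> rk; rewrite !(free_miss (al k)) !(miss_rmark _ c rk) eqxx.
by case: (al k).
Qed.

Lemma alive_rmark z m k c : rel m k = None ->
  alive z (rmark m k c) = alive z m && ~~ ((al k == z) && c).
Proof.
move=> rk; apply/forallP/andP => [H|[/forallP H nk] l]; last first.
  rewrite rel_mark; case: (l =P k) => [->|_]; last exact: H.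
  by case: (al k == z) nk; case: (c).
split; first apply/forallP => l.
  have := H l; rewrite rel_mark; case: (l =P k) => [->|//] _.
  by rewrite rk implybT.
by have := H k; rewrite rel_mark eqxx; case: (al k == z); case: (c).
Qed.

Lemma fullP z m : reflect (full z m) (alive z m && (miss z m == 0)).
Proof.
apply: (iffP andP) => [[/forallP H /eqP/card0_eq M] k ak|H].
  have := H k; have := M k; rewrite !inE ak eqxx /=.
  by case: (rel m k) => [[]|].
split; first by apply/forallP => k; apply/implyP => /eqP/H->.
by apply/eqP/eq_card0 => k; rewrite !inE; case: eqP => //= /H->.
Qed.

(** Marked neighbours in the same cell already run against the chord, and at a joint an arrow
    against the chord conflicts with nothing. *)
Lemma valid_against m k : valid m -> alive (al k) m -> valid (rmark m k false).
Proof.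
move=> V /forallP H; apply: valid_rmark => //; rewrite /pair_ok.
  have := H (p k); have [Jp|Jp] := boolP (joint (p k)).
    by case: (rel m (p k)) => // x; rewrite andbF.
  have -> : al (p k) = al k by rewrite -(along_nonjoint d Jp) ord_predK.
  by rewrite eqxx; case: (rel m (p k)) => // -[].
have := H (s k); have [Jk|Jk] := boolP (joint k); first by case: (rel m (s k)).
by rewrite along_nonjoint // eqxx; case: (rel m (s k)) => // -[].
Qed.

Lemma wins_has_move m : wins ends cells m -> has_move ends m.
Proof. by case=> m' e x L _; apply/existsP; exists e; apply/existsP; exists x. Qed.

Lemma wins_rmark m k c : rel m k = None -> valid (rmark m k c) ->
  [\/ has_cycle_cell cells (rmark m k c), ~~ has_move ends (rmark m k c)
    | loses ends cells (rmark m k c)] -> wins ends cells m.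
Proof.
move=> rk V H; apply: (WinMove (rmark_legal rk V)).
by case: H => H; [left|right; left|right; right].
Qed.

Lemma safe_nocycle m k c : valid m -> safe m -> rel m k = None ->
  ~~ has_cycle_cell cells (rmark m k c).
Proof.
move=> [md _] S rk; apply/negP => /cycle_cellP[|z /fullP]; first by rewrite rmarkN.
rewrite alive_rmark // => /andP[/andP[al_z _] /eqP m0].
by have := S z; rewrite /near al_z (miss_rmark z c rk) m0; case: (al k == z).
Qed.

Lemma loses_of_replies m : valid m -> safe m -> has_move ends m ->
  (forall k c, rel m k = None -> valid (rmark m k c) ->
     ~~ has_cycle_cell cells (rmark m k c) -> wins ends cells (rmark m k c)) ->
  loses ends cells m.
Proof.
move=> V S hm H; apply: (LoseAll hm) => e x /(legal_valid V)[k [c [-> rk V']]].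
have nc := safe_nocycle c V S rk; have W := H k c rk V' nc.
by split; [exact: nc | exact: wins_has_move W | exact: W].
Qed.

Lemma near_wins z m : valid m -> ~~ has_cycle_cell cells m -> near z m ->
  wins ends cells m.
Proof.
move=> V nc /andP[Az]; rewrite leq_eqVlt ltnS leqn0 => /orP[M1|M0]; last first.
  case/cycle_cellP: nc; first by case: V.
  by exists z; apply/fullP; rewrite Az M0.
have [k] : exists k, k \in [pred k | (al k == z) && (rel m k == None)].
  by apply/card_gt0P; rewrite -/(miss z m) (eqP M1).
rewrite inE => /andP[/eqP ak /eqP rk].
have V' : valid (rmark m k false) by apply: valid_against; rewrite ?ak.
apply: (wins_rmark rk V'); constructor 1; apply/cycle_cellP; first by case: V'.
exists z; apply/fullP; rewrite alive_rmark // Az andbF /=.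
by move: M1; rewrite (miss_rmark z false rk) ak eqxx.
Qed.

(** * Parity endgame *)

(** At a joint, an arrow along the chord forces the other cycle edge to run against it. Since [al]
    flips there, both then turn the same way around the cycle. *)
Definition won m j := (rel m j == Some true) || (rel m (s j) == Some true).
Definition settled m := forall j, joint j -> won m j.

Lemma won_rmark m k c j : rel m k = None -> won m j -> won (rmark m k c) j.
Proof.
move=> rk /orP[] /eqP rj; apply/orP; [left|right]; rewrite rel_mark rj;
  by case: (_ =P k) => // e; move: rj; rewrite e rk.
Qed.

(* Once both joints are settled, the vertex rule says that marked neighbours
   turn the same way around the cycle, also at the two ends of the chord. *)
Lemma settled_pair m k x y : settled m -> valid m ->
  m (Some k) = Some x -> m (Some (s k)) = Some y -> x = y.
Proof.
move=> W [md V] mk ms; have := V k; have := W k.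
rewrite /won /rel mk ms /= along_succ; case: (joint k) => [/(_ isT)|_];
  by case: (x); case: (y); case: (al k).
Qed.

(** A marked neighbour allows exactly its own direction around the cycle: across a settled joint the
    marked edge must be the one along the chord. So both neighbours are needed to block both
    directions. *)
Lemma settled_stuck m k : settled m -> valid m -> rel m k = None ->
  (forall c, ~ valid (rmark m k c)) ->
  exists x, m (Some (p k)) = Some x /\ m (Some (s k)) = Some (~~ x).
Proof.
move=> W V rk stuck.
have L y x : m (Some (p k)) = Some y ->
    pair_ok (joint (p k)) (rel m (p k)) (Some (x == al k)) = (y == x).
  move=> mp; have ek : al k = al (p k) (+) joint (p k) by rewrite -along_succ ord_predK.
  rewrite /rel mp /= ek.
  have := W (p k); rewrite /won ord_predK rk orbF /rel mp /=.
  by case: (joint (p k)) => [/(_ isT)|_]; case: (y); case: (x); case: (al (p k)).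
have R y x : m (Some (s k)) = Some y ->
    pair_ok (joint k) (Some (x == al k)) (rel m (s k)) = (y == x).
  move=> mp; rewrite /rel mp /= along_succ.
  have := W k; rewrite /won rk /= /rel mp /= along_succ.
  by case: (joint k) => [/(_ isT)|_]; case: (y); case: (x); case: (al k).
have H x : pair_ok (joint (p k)) (rel m (p k)) (Some (x == al k)) ->
           pair_ok (joint k) (Some (x == al k)) (rel m (s k)) -> False.
  by move=> H1 H2; apply: (stuck (x == al k)); apply: valid_rmark.
case mp: (m (Some (p k))) => [x|]; case ms: (m (Some (s k))) => [y|].
- exists x; split=> //; congr Some; move: (H x); rewrite (L _ _ mp) (R _ _ ms) eqxx.
  by case: (x); case: (y) => // /(_ isT isT).
- by case: (H x); rewrite ?(L _ _ mp) ?eqxx // /rel ms.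
- by case: (H y); rewrite ?(R _ _ ms) ?eqxx // /rel mp.
- by case: (H true); rewrite /rel ?ms ?mp.
Qed.

(* Give an unmarked edge the colour of its predecessor. If no edge can be
   marked, the colours change exactly after the unmarked edges, and a cyclic
   word has an even number of changes. *)
Lemma settled_move m : settled m -> valid m -> odd (free m) ->
  exists k c, rel m k = None /\ valid (rmark m k c).
Proof.
move=> W V oddf.
pose ok k c :=
  [forall l, pair_ok (joint l) (rel (rmark m k c) l) (rel (rmark m k c) (s l))].
case: (boolP [exists k, exists c, (rel m k == None) && ok k c]) => [|NM].
  move=> /existsP[k /existsP[c /andP[/eqP rk /forallP H]]]; exists k, c; split=> //.
  by split=> //; rewrite rmarkN; case: V.
exfalso; move: oddf; apply/negP.
have stuck k : rel m k = None ->
    exists x, m (Some (p k)) = Some x /\ m (Some (s k)) = Some (~~ x).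
  by move=> rk; apply: settled_stuck => // c V'; move/negP: NM; apply;
    apply/existsP; exists k; apply/existsP; exists c; rewrite rk; apply/forallP; case: V'.
(* By [stuck] the predecessor of an unmarked edge is marked, so the default [false] is never
   reached. *)
pose col k := if m (Some k) is Some x then x else odflt false (m (Some (p k))).
have step k : (rel m k == None) = col k (+) col (s k).
  rewrite /col ordSK rel_None.
  case mk: (m (Some k)) => [x|]; last first.
    have [|x [-> ->]] := stuck k; first by rewrite /rel mk.
    by case: (x).
  case ms: (m (Some (s k))) => [y|] /=; last by rewrite addbb.
  by rewrite (settled_pair W V mk ms) addbb.
have -> : odd (free m) = \big[addb/false]_k (rel m k == None).
  rewrite /free -sum1_card big_mkcond /= (big_morph odd oddD (erefl : odd 0 = false)).
  by apply: eq_bigr => k _; rewrite inE; case: (_ == None).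
under eq_bigr do rewrite step.
by rewrite big_split /= [X in X (+) _](reindex_inj (@ordS_inj n)) addbb.
Qed.

(** A move changes only the cell of its edge, and there it removes just one gap. *)
Lemma safe_rmarkVnear m k c : safe m -> rel m k = None ->
  safe (rmark m k c) \/ [/\ c = false, alive (al k) m & miss (al k) m = 2].
Proof.
move=> S rk.
have H z : near z (rmark m k c) -> [/\ z = al k, c = false, alive z m & miss z m = 2].
  rewrite /near alive_rmark // => /andP[/andP[Az nc] M]; have := S z.
  rewrite /near Az (miss_rmark z c rk); case: eqP nc => /= [->|_ _]; last first.
    by move=> /negP[].
  by move=> /negbTE c0 nM; split=> //; lia.
have [/H[<- -> ? ?]|nt] := boolP (near true (rmark m k c)); first by right.
have [/H[<- -> ? ?]|nf] := boolP (near false (rmark m k c)); first by right.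
by left; case.
Qed.

Lemma valid_sub m m' : valid m' -> m None = Some d ->
  (forall k, rel m k = rel m' k \/ rel m k = None) -> valid m.
Proof.
move=> [_ V] md H; split=> // k; have := V k.
case: (H k) => ->; case: (H (s k)) => -> //.
by case: (rel m' k).
Qed.

(* If every legal move left a cell with a single gap, filling up the two gaps
   of such a cell would keep the parity, so there would be a move in the other
   cell, which then has two gaps as well. *)
Lemma settled_safe_move m : settled m -> valid m -> odd (free m) -> safe m ->
  exists k c, [/\ rel m k = None, valid (rmark m k c) & safe (rmark m k c)].
Proof.
move=> W V oddf S.
have [k [c [rk Vk]]] := settled_move W V oddf.
case: (safe_rmarkVnear c S rk) => [Sk|[c0 Ak Mk]]; first by exists k, c.
subst c; set m1 := rmark m k false in Vk.
have M1 : miss (al k) m1 = 1.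
  by move: Mk; rewrite (miss_rmark _ false rk) eqxx add1n => -[].
have [k1] : exists l, l \in [pred l | (al l == al k) && (rel m1 l == None)].
  by apply/card_gt0P; rewrite -/(miss (al k) m1) M1.
rewrite inE => /andP[/eqP ak1 /eqP rk1].
have A1 : alive (al k) m1 by rewrite alive_rmark // Ak andbF.
have V2 : valid (rmark m1 k1 false) by apply: valid_against; rewrite ?ak1.
set m2 := rmark m1 k1 false in V2.
have W2 : settled m2 by move=> j Jj; do 2! apply: won_rmark => //; exact: W.
have odd2 : odd (free m2).
  by move: oddf; rewrite (free_rmark false rk) (free_rmark false rk1) /= negbK.
have M2 : miss (al k) m2 = 0.
  by move: M1; rewrite (miss_rmark _ false rk1) ak1 eqxx add1n => -[].
have [k2 [c [rk2 Vk2]]] := settled_move W2 V2 odd2.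
have ak2 : al k2 = ~~ al k.
  have /card0_eq/(_ k2) := M2; rewrite !inE rk2 eqxx andbT.
  by case: (al k2); case: (al k).
have rk2m : rel m k2 = None.
  by move: rk2; rewrite !rel_mark; do 2! case: ifP => //.
(* Erasing the two fillers [k] and [k1] keeps the vertex rule, so the move found in [m2] is already
   possible in [m]. *)
have Vm : valid (rmark m k2 c).
  apply: (valid_sub Vk2); first by rewrite rmarkN; case: V.
  move=> l; rewrite !rel_mark; case: (l == k2); first by left.
  case: eqP => [->|_]; last by case: eqP => [->|_]; [right|left].
  by right; move: rk1; rewrite rel_mark; case: ifP.
case: (safe_rmarkVnear c S rk2m) => [Sk2|[c0 Ak2 Mk2]]; first by exists k2, c.
(* Otherwise both cells have exactly two gaps and [free m] would be 4. *)
by move: oddf; rewrite (free_miss (al k)) Mk -ak2 Mk2.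
Qed.

(** [loses] requires a legal move, so the stuck positions, where the last mover wins, are added. *)
Definition lost m := ~~ has_move ends m \/ loses ends cells m.

Lemma lost_of_replies m : valid m -> safe m ->
  (forall k c, rel m k = None -> valid (rmark m k c) ->
     ~~ has_cycle_cell cells (rmark m k c) -> wins ends cells (rmark m k c)) ->
  lost m.
Proof.
move=> V S H; have [hm|] := boolP (has_move ends m); last by left.
by right; apply: loses_of_replies.
Qed.

Lemma wins_of_lost m k c : rel m k = None -> valid (rmark m k c) ->
  lost (rmark m k c) -> wins ends cells m.
Proof.
by move=> rk V H; apply: (wins_rmark rk V); case: H => H; [constructor 2|constructor 3].
Qed.

Lemma safe_or_near m : safe m \/ exists z, near z m.
Proof.
have [nt|nt] := boolP (near true m); first by right; exists true.
have [nf|nf] := boolP (near false m); first by right; exists false.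
by left; case.
Qed.

(** A safe move gives the opponent no cell to complete, and after any reply the number of gaps is
    odd again. *)
Lemma settled_wins m : settled m -> valid m -> odd (free m) ->
  ~~ has_cycle_cell cells m -> wins ends cells m.
Proof.
have [N] := ubnP (free m); elim: N m => // N IH m leN W V oddf nc.
have [S|[z]] := safe_or_near m; last exact: near_wins.
have [k [c [rk V1 S1]]] := settled_safe_move W V oddf S.
apply: (wins_of_lost rk V1); apply: lost_of_replies => // k' c' rk' V2 nc2.
move: leN oddf; rewrite (free_rmark c rk) (free_rmark c' rk') => leN /=.
rewrite negbK => oddf; apply: IH => //; first by lia.
by move=> j Jj; do 2! apply: won_rmark => //; exact: W.
Qed.

Lemma settled_lost m : settled m -> valid m -> ~~ odd (free m) -> safe m -> lost m.
Proof.
move=> W V evf S; apply: lost_of_replies => // k c rk V' nc.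
apply: settled_wins => //; first by move=> j /W; exact: won_rmark.
by move: evf; rewrite (free_rmark c rk) /= negbK.
Qed.

Lemma jointE k : joint k = al k (+) al (s k).
Proof. by rewrite along_succ addbA addbb. Qed.

Lemma pair_okC (j : bool) (x y : option bool) : pair_ok j x y = pair_ok j y x.
Proof. by case: x y => [[]|] [[]|]; case: j. Qed.

Lemma miss_ge2 z m k l : k != l -> al k = z -> al l = z ->
  rel m k = None -> rel m l = None -> 1 < miss z m.
Proof.
by move=> kl ak al_ rk rl; apply/card_gt1P; exists k, l; rewrite !inE ak al_ rk rl !eqxx.
Qed.

(** * Reflection strategy on the arc opposite to an arc of length 3 *)

Section Mirror.

Variable y : 'I_n.

Lemma mirror_subproof k :
  (if k <= y + y then if y + y - k < n then y + y - k else y + y - k - n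
   else y + y + n - k) < n.
Proof. by have := ltn_ord y; have := ltn_ord k; do !case: ifP; lia. Qed.

(* The reflection [k |-> 2 y - k] modulo [n]. *)
Definition mirror k : 'I_n := Ordinal (mirror_subproof k).

Lemma mirrorE k : mirror k =
  (if k <= y + y then if y + y - k < n then y + y - k else y + y - k - n
   else y + y + n - k) :> nat.
Proof. by []. Qed.

Lemma mirrorK : involutive mirror.
Proof.
move=> k; apply/eqP; rewrite ord_eqE 2!mirrorE.
by have := ltn_ord y; have := ltn_ord k; do !case: ifP; lia.
Qed.

Lemma mirror_center : mirror y = y.
Proof. by apply/eqP; rewrite ord_eqE mirrorE; have := ltn_ord y; do !case: ifP; lia. Qed.

Lemma mirror_succ k : s (mirror (s k)) = mirror k.
Proof.
apply/eqP; rewrite ord_eqE val_ordS !mirrorE val_ordS.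
by have := ltn_ord y; have := ltn_ord k; do !case: ifP; lia.
Qed.

Lemma mirror_s_center : mirror (s y) = p y.
Proof. by apply: ordS_inj; rewrite mirror_succ ord_predK mirror_center. Qed.

Lemma mirror_p_center : mirror (p y) = s y.
Proof. by rewrite -mirror_s_center mirrorK. Qed.

Lemma mirror_fix_odd l : odd n -> mirror l = l -> l = y.
Proof.
move=> oddn /eqP e; apply/eqP; move: e; rewrite !ord_eqE mirrorE.
by have := ltn_ord y; have := ltn_ord l; do !case: ifP; lia.
Qed.

Lemma mirror_fix_even : ~~ odd n -> 4 < n -> exists k0,
  [/\ mirror k0 = k0, k0 \notin [:: p y; y; s y]
    & forall l, mirror l = l -> l = y \/ l = k0].
Proof.
move=> evn n5; have ly := ltn_ord y.
have lt0 : (if y + n./2 < n then y + n./2 else y + n./2 - n) < n by case: ifP; lia.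
(* The edge opposite [y]: the second solution of [2 l = 2 y] modulo an even [n]. *)
exists (Ordinal lt0); split.
- by apply/eqP; rewrite ord_eqE mirrorE /=; do !case: ifP; lia.
- rewrite !inE -(inj_eq (@ordS_inj n) _ (p y)) ord_predK !ord_eqE !val_ordS /=.
  by do !case: ifP; lia.
- move=> l /eqP e; suff: (l == y) || (l == Ordinal lt0).
    by case/orP=> /eqP; [left|right].
  move: e; rewrite !ord_eqE mirrorE /=; have := ltn_ord l.
  by do !case: ifP; lia.
Qed.

Hypotheses (Ny : ~~ joint y) (Npy : ~~ joint (p y)).
Hypothesis cell_y : forall k, al k = al y -> k \in [:: p y; y; s y].

Lemma along_sy : al (s y) = al y. Proof. exact: along_nonjoint. Qed.

Lemma along_py : al (p y) = al y.
Proof. by rewrite -[in RHS](ord_predK y) along_nonjoint. Qed.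

Lemma in_cell_y k : (al k == al y) = (k \in [:: p y; y; s y]).
Proof.
apply/eqP/idP => [/cell_y //|]; rewrite !inE => /or3P[] /eqP-> //.
  exact: along_py.
exact: along_sy.
Qed.

Lemma along_mirror k : al (mirror k) = al k.
Proof.
suff : (al (mirror k) == al y) = (al k == al y).
  by case: (al _); case: (al k); case: (al y).
have H l : al l == al y -> al (mirror l) == al y.
  rewrite !in_cell_y !inE => /or3P[] /eqP->;
  by rewrite ?mirror_p_center ?mirror_center ?mirror_s_center eqxx ?orbT.
by apply/idP/idP => /H //; rewrite mirrorK.
Qed.

Lemma joint_mirror k : joint (mirror (s k)) = joint k.
Proof. by rewrite !jointE mirror_succ !along_mirror addbC. Qed.

(** Reflection swaps the chord ends, so equal colours mean that arrows are reflected and then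
    reversed. The arrow along the chord lies off the arc around [y] and kills the other cell. Fixed
    edges are marked, so every move off the arc has a distinct mirror image to reply on. *)
Record mirrored m : Prop := Mirrored {
  mirrored_valid : valid m;
  mirrored_y : rel m y = Some false;
  mirrored_sy : rel m (s y) = None;
  mirrored_py : rel m (p y) = None;
  mirrored_sym : forall k, rel m (mirror k) = rel m k;
  mirrored_true : exists k, rel m k = Some true;
  mirrored_fix : forall k, mirror k = k -> rel m k != None }.

Lemma mirrored_alive m : mirrored m -> alive (al y) m.
Proof.
move=> M; apply/forallP => k; apply/implyP; rewrite in_cell_y !inE.
by case/or3P=> /eqP->; rewrite ?mirrored_y ?mirrored_sy ?mirrored_py.
Qed.

Lemma sy_neq_py : s y != p y.
Proof.
apply/eqP => e; have := ordS_neq (s y); rewrite {1}e ord_predK => ne.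
have := ltn_ord y; move/(congr1 s)/eqP: e; rewrite ord_predK ord_eqE !val_ordS.
by do !case: ifP; lia.
Qed.

Lemma mirrored_safe m : mirrored m -> safe m.
Proof.
move=> M z; rewrite /near.
have [->|nz] := eqVneq z (al y).
  rewrite negb_and -ltnNge orbC (@miss_ge2 _ _ (s y) (p y)) //.
  - exact: sy_neq_py.
  - exact: along_sy.
  - exact: along_py.
  - exact: mirrored_sy.
  - exact: mirrored_py.
rewrite negb_and; have [k rk] := mirrored_true M; apply/orP; left.
apply/forallPn; exists k; rewrite rk negb_imply eqxx andbT.
have : al k != al y.
  rewrite in_cell_y !inE; apply/negP => /or3P[] /eqP e; move: rk; rewrite e;
  by rewrite ?mirrored_y ?mirrored_sy ?mirrored_py.
by move: nz; case: (z); case: (al k); case: (al y).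
Qed.

(** A vertex touching only one of the two new arrows is legal by [V1] or by symmetry. A vertex
    between both is no joint, and they have equal colours. *)
Lemma mirror_valid m k c : mirrored m -> rel m k = None -> valid (rmark m k c) ->
  valid (rmark (rmark m k c) (mirror k) c).
Proof.
move=> M rk [md V1]; split; first by rewrite rmarkN.
set m1 := rmark m k c in V1 *; set m2 := rmark m1 _ c.
have rel2 l : rel m2 l = if (l == mirror k) || (l == k) then Some c else rel m l.
  by rewrite !rel_mark; case: (l == mirror k).
have sym2 l : rel m2 (mirror l) = rel m2 l.
  rewrite !rel2 mirrored_sym // (inj_eq (inv_inj mirrorK)).
  by rewrite -{2}(mirrorK k) (inj_eq (inv_inj mirrorK)) orbC.
have H l : l != mirror k -> s l != mirror k ->
    pair_ok (joint l) (rel m2 l) (rel m2 (s l)).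
  move=> /negbTE n1 /negbTE n2.
  have e l' : (l' == mirror k) = false -> rel m2 l' = rel m1 l' by rewrite rel_mark => ->.
  by rewrite !e.
move=> l; have [/andP[]|] := boolP ((l != mirror k) && (s l != mirror k)).
  exact: H.
(* A vertex that avoids [k] reflects to one that avoids [mirror k]. *)
have [/andP[n1 n2] _|] := boolP ((l != k) && (s l != k)).
  rewrite -joint_mirror pair_okC -(sym2 l) -(sym2 (s l)) -(mirror_succ l).
  by apply: H; rewrite ?mirror_succ (inj_eq (inv_inj mirrorK)).
rewrite !negb_and !negbK => lk lk'.
have nk : mirror k != k.
  by apply/eqP => /(mirrored_fix M); rewrite rk.
have -> : joint l = false.
  rewrite jointE; case/orP: lk => /eqP e; case/orP: lk' => /eqP e'.
  - by move: nk; rewrite -e' -e eqxx.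
  - by rewrite e' e along_mirror addbb.
  - by rewrite e e' along_mirror addbb.
  - by move: nk; rewrite -e' -e eqxx.
rewrite !rel2; case/orP: lk => /eqP e; case/orP: lk' => /eqP e'.
- by move: nk; rewrite -e' -e eqxx.
- by rewrite e' e !eqxx orbT /=.
- by rewrite e e' !eqxx orbT /=.
- by move: nk; rewrite -e' -e eqxx.
Qed.

(** Moves off the short arc are answered by their mirror image. The move on [s y] stays available,
    so the opponent never gets stuck and must finally enter the short arc, leaving a single gap. *)
Lemma mirrored_loses m : mirrored m -> loses ends cells m.
Proof.
have [N] := ubnP (free m); elim: N m => // N IH m leN M.
have V := mirrored_valid M; have S := mirrored_safe M; have A := mirrored_alive M.
apply: loses_of_replies => //.
  apply/existsP; exists (Some (s y)); apply/existsP; exists (false == al (s y)).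
  apply: rmark_legal; first exact: mirrored_sy.
  by apply: valid_against; rewrite ?along_sy.
move=> k c rk V1 nc1; have [kY|kX] := boolP (al k == al y).
  (* The arrow on [y], reached through a vertex off the chord, forces the colour. *)
  have c0 : c = false.
    have [H1 H2] := valid_unmark V V1.
    move: kY rk H1 H2; rewrite in_cell_y !inE => /or3P[] /eqP->.
    - by rewrite ord_predK (negbTE Npy) mirrored_y // => _ _ /eqP.
    - by rewrite mirrored_y.
    - by rewrite ordSK (negbTE Ny) mirrored_y // => _ /eqP.
  apply: (@near_wins (al y)) => //; rewrite /near alive_rmark // A c0 andbF /=.
  rewrite (leq_trans (subset_leq_card (_ : _ \subset pred1 (mirror k)))) ?card1 //.
  apply/subsetP => l; rewrite [l \in _]inE /= rel_mark in_cell_y => /andP[lY].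
  case: (l =P k) => // nl /eqP rl; rewrite inE; move: kY lY; rewrite in_cell_y !inE.
  move=> /or3P[] /eqP ek /or3P[] /eqP el; move: rk rl nl; rewrite ek el;
  by rewrite ?mirrored_y // ?mirror_s_center ?mirror_p_center ?eqxx.
have rk' : rel (rmark m k c) (mirror k) = None.
  rewrite rel_mark mirrored_sym // rk; case: eqP => // /(mirrored_fix M).
  by rewrite rk.
have V2 := mirror_valid M rk V1.
apply: (wins_of_lost rk' V2); right; apply: IH.
  by move: leN; rewrite (free_rmark c rk) (free_rmark c rk'); lia.
have nY l : l \in [:: p y; y; s y] -> (l == mirror k = false) * (l == k = false).
  move=> lY; split; apply/negbTE; apply: contraNneq kX => e.
    by rewrite -along_mirror -e in_cell_y.
  by rewrite -e in_cell_y.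
have rel2 l : rel (rmark (rmark m k c) (mirror k) c) l =
    if (l == mirror k) || (l == k) then Some c else rel m l.
  by rewrite !rel_mark; case: (l == mirror k).
split=> // [||| l | | l /(mirrored_fix M) ].
- by rewrite rel2 !nY ?mirrored_y // !inE eqxx ?orbT.
- by rewrite rel2 !nY ?mirrored_sy // !inE eqxx ?orbT.
- by rewrite rel2 !nY ?mirrored_py // !inE eqxx ?orbT.
- rewrite !rel2 mirrored_sym // (inj_eq (inv_inj mirrorK)).
  by rewrite -{2}(mirrorK k) (inj_eq (inv_inj mirrorK)) orbC.
- have [l rl] := mirrored_true M; exists l; rewrite rel2.
  case: eqP => [e|_]; first by move: rl; rewrite e mirrored_sym // rk.
  by case: eqP => [e|_] //; move: rl; rewrite e rk.
- by rewrite rel2; case: ifP.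
Qed.

(** Marking [k0] along the chord creates a [mirrored] position. This covers two cases: [k0] is the
    second fixed edge and only [y] is marked, or [k0] is the mirror image of an earlier arrow along
    the chord. *)
Lemma mirror_entry m k0 : valid m -> k0 \notin [:: p y; y; s y] ->
  (forall l, rel m l = if l == y then Some false
     else if (l == mirror k0) && (l != k0) then Some true else None) ->
  (forall l, mirror l = l -> l = y \/ l = k0) ->
  wins ends cells m.
Proof.
move=> V k0Y relm fixm; have ak0 : al k0 != al y by rewrite in_cell_y.
move: (k0Y); rewrite !inE !negb_or => /and3P[k0py k0y k0sy].
have rk0 : rel m k0 = None by rewrite relm (negbTE k0y) eqxx andbF.
have nY l : l \in [:: p y; y; s y] -> (l == mirror k0 = false) * (l == k0 = false).
  move=> lY; split; apply/negbTE; apply: contraNneq ak0 => e.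
    by rewrite -along_mirror -e in_cell_y.
  by rewrite -e in_cell_y.
have V' : valid (rmark m k0 true).
  apply: valid_rmark => //; rewrite relm.
    case: eqP => [e|_]; first by rewrite -e ord_predK eqxx in k0sy.
    case: ifP => // /andP[/eqP e _] /=.
    by rewrite jointE ord_predK e along_mirror addbb.
  case: eqP => [e|_]; first by rewrite -e ordSK eqxx in k0py.
  by case: ifP => // /andP[/eqP e _] /=; rewrite jointE e along_mirror addbb.
apply: (wins_of_lost rk0 V'); right; apply: mirrored_loses.
have rel2 l : rel (rmark m k0 true) l = if l == y then Some false
    else if (l == mirror k0) || (l == k0) then Some true else None.
  rewrite rel_mark relm; case: (l =P k0) => [->|_]; first by rewrite (negbTE k0y) orbT.
  by rewrite andbT orbF.
split=> // [||| l | | l /fixm[] ->].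
- by rewrite rel2 eqxx.
- by rewrite rel2 !nY ?inE ?eqxx ?orbT // (negbTE (ordS_neq y)).
- by rewrite rel2 !nY ?inE ?eqxx // (negbTE (ord_pred_neq y)).
- rewrite !rel2 -{1}mirror_center !(inj_eq (inv_inj mirrorK)).
  by rewrite -{2}(mirrorK k0) (inj_eq (inv_inj mirrorK)) orbC.
- by exists k0; rewrite rel2 (negbTE k0y) eqxx orbT.
- by rewrite rel2 eqxx.
- by rewrite rel2 (negbTE k0y) eqxx orbT.
Qed.

End Mirror.

(** * Securing the ends of the chord *)

(** At a joint [j], the edges [p j] and [j] must get equal colours, so an arrow against the chord on
    either one spoils [j]. *)
Definition can_left m j := (rel m j != Some false) && (rel m (p j) != Some false).
Definition can_right m j :=
  (rel m (s j) != Some false) && (rel m (s (s j)) != Some false).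
(** A good end is still weak after any single move, and a weak end can be won in one move. *)
Definition good m j := won m j || can_left m j && can_right m j.
Definition weak m j := [|| won m j, can_left m j | can_right m j].

Lemma joint_cases i j j' : joint i -> joint j -> joint j' -> j != j' -> i = j \/ i = j'.
Proof.
move=> Ji Jj Jj' ne.
suff: (s i == s j) || (s i == s j').
  by rewrite !(inj_eq (@ordS_inj n)) => /orP[] /eqP; [left|right].
move: ne; rewrite -(inj_eq (@ordS_inj n)).
case/orP: Ji => /eqP->; case/orP: Jj => /eqP->; case/orP: Jj' => /eqP->;
  by rewrite ?eqxx ?orbT.
Qed.

Lemma neq_false_rmark m k l :
  rel m l != Some false -> rel (rmark m k true) l != Some false.
Proof. by rewrite rel_mark; case: ifP. Qed.

Lemma good_along m k j : rel m k = None -> good m j -> good (rmark m k true) j.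
Proof.
move=> rk /orP[/(won_rmark true rk) W|]; first by rewrite /good W.
move=> /andP[/andP[h1 h2] /andP[h3 h4]]; apply/orP; right.
by rewrite /can_left /can_right !neq_false_rmark.
Qed.

Lemma can_left_off m k c j : joint j -> al k != al j -> can_left m j ->
  can_left (rmark m k c) j.
Proof.
move=> Jj ak; rewrite /can_left !rel_mark.
have apj : al (p j) = al j by rewrite -(along_nonjoint d (joint_pred Jj)) ord_predK.
have [e|_] := eqVneq j k; first by rewrite e eqxx in ak.
by have [e|//] := eqVneq (p j) k; rewrite -e apj eqxx in ak.
Qed.

Lemma can_right_off m k c j : joint j -> al k != al (s j) -> can_right m j ->
  can_right (rmark m k c) j.
Proof.
move=> Jj ak; rewrite /can_right !rel_mark.
have asj := along_nonjoint d (joint_succ Jj).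
have [e|_] := eqVneq (s j) k; first by rewrite e eqxx in ak.
by have [e|//] := eqVneq (s (s j)) k; rewrite -e asj eqxx in ak.
Qed.

(** The two sides of a joint lie in different cells, and one move touches only one cell. *)
Lemma good_weak m k c j : joint j -> rel m k = None -> good m j ->
  weak (rmark m k c) j.
Proof.
move=> Jj rk /orP[/(won_rmark c rk) W|/andP[L R]]; first by rewrite /weak W.
have [e|ne] := eqVneq (al k) (al j); last by rewrite /weak can_left_off // orbT.
by rewrite /weak (@can_right_off m k c j) ?orbT // e along_joint //; case: (al j).
Qed.

(** Locates the damage within two edges of the joint, so that damage to both ends at once pins down
    a short arc. *)
Lemma broken m k c j : joint j -> rel m k = None -> good m j ->
  ~~ good (rmark m k c) j ->
  c = false /\ if al k == al j then k \in [:: p j; j] else k \in [:: s j; s (s j)].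
Proof.
move=> Jj rk G nG; have c0 : c = false.
  by case: c nG => // /negP[]; exact: good_along.
split=> //; move: G nG; rewrite /good => /orP[/(won_rmark c rk)-> //|/andP[L R]].
rewrite negb_or negb_and => /andP[_]; case: ifP => [/eqP e|/negbT ne].
  rewrite [can_right _ _](@can_right_off m k c j) // ?orbF; last first.
    by rewrite e along_joint //; case: (al j).
  move: L; rewrite /can_left !rel_mark !inE [k == p j]eq_sym [k == j]eq_sym.
  by case: (p j == k); case: (j == k) => //= ->.
rewrite [can_left _ _]can_left_off //=.
move: R; rewrite /can_right !rel_mark !inE [k == s j]eq_sym [k == s (s j)]eq_sym.
by case: (s j == k); case: (s (s j) == k) => //= ->.
Qed.

Lemma make_won m j : joint j -> valid m -> weak m j -> ~~ won m j ->
  exists k, [/\ rel m k = None, valid (rmark m k true) & won (rmark m k true) j].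
Proof.
move=> Jj V wk nw; move: wk; rewrite /weak (negbTE nw) /= => can.
move: nw; rewrite /won negb_or => /andP[n1 n2]; case/orP: can => /andP[h1 h2].
  exists j; split; first by move: n1 h1; case: (rel m j) => [[]|].
    apply: valid_rmark => //; rewrite ?Jj ?(negbTE (joint_pred Jj)) /=.
      by move: h2; case: (rel m (p j)) => [[]|].
    by move: n2; case: (rel m (s j)) => [[]|].
  by rewrite rel_mark eqxx.
exists (s j); split; first by move: n2 h1; case: (rel m (s j)) => [[]|].
  apply: valid_rmark => //; rewrite ?ordSK ?Jj ?(negbTE (joint_succ Jj)) /=.
    by move: n1; case: (rel m j) => [[]|].
  by move: h2; case: (rel m (s (s j))) => [[]|].
by apply/orP; right; rewrite rel_mark eqxx.
Qed.

Lemma safe_along m k : safe m -> rel m k = None -> safe (rmark m k true).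
Proof. by move=> S rk; case: (safe_rmarkVnear true S rk) => // -[]. Qed.

Lemma won_weak_wins m j j' : joint j -> joint j' -> j != j' ->
  valid m -> odd (free m) -> ~~ has_cycle_cell cells m ->
  won m j -> weak m j' -> wins ends cells m.
Proof.
move=> Jj Jj' ne V oddf nc Wj wk.
have [S|[z]] := safe_or_near m; last exact: near_wins.
have [Wj'|nW] := boolP (won m j').
  by apply: settled_wins => // i Ji; case: (joint_cases Ji Jj Jj' ne) => ->.
have [k [rk V' W']] := make_won Jj' V wk nW.
apply: (wins_of_lost rk V'); apply: settled_lost => //.
- by move=> i Ji; case: (joint_cases Ji Jj Jj' ne) => -> //; exact: won_rmark.
- by move: oddf; rewrite (free_rmark true rk).
- exact: safe_along.
Qed.

(** The weak end is won first; the good one survives the reply as weak and is won next. *)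
Lemma good_weak_wins m j j' : joint j -> joint j' -> j != j' ->
  valid m -> odd (free m) -> ~~ has_cycle_cell cells m ->
  good m j -> weak m j' -> wins ends cells m.
Proof.
move=> Jj Jj' ne V oddf nc Gj wk.
have [S|[z]] := safe_or_near m; last exact: near_wins.
have [Wj'|nW] := boolP (won m j').
  apply: (@won_weak_wins m j' j) => //; first by rewrite eq_sym.
  by case/orP: Gj => [W|/andP[L _]]; rewrite /weak ?W ?L ?orbT.
have [k [rk V' W']] := make_won Jj' V wk nW.
apply: (wins_of_lost rk V'); apply: lost_of_replies => //; first exact: safe_along.
move=> k' c rk' V2 nc2; apply: (@won_weak_wins _ j' j) => //.
- by rewrite eq_sym.
- by move: oddf; rewrite (free_rmark true rk) (free_rmark c rk') /= negbK.
- exact: won_rmark.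
- by apply: good_weak => //; exact: good_along.
Qed.

(** * The position after the opening *)

Section Opening.

(** [ox] is the cycle edge marked before the chord: none for even [n], where the chord comes first,
    and Player 1's first edge for odd [n]. *)
Variables (m : position) (ox : option 'I_n).
Hypothesis Vm : valid m.
Hypothesis relm : forall l, rel m l = if Some l == ox then Some true else None.
Hypothesis parity : odd n = ox :> bool.

Lemma opening_good j : good m j.
Proof. by rewrite /good /can_left /can_right !relm; do 4! case: ifP; rewrite ?orbT. Qed.

Lemma opening_safe : safe m.
Proof.
move=> z; apply/negP => /andP[/forallP A]; apply/negP; rewrite -ltnNge.
have N k : al k = z -> rel m k = None.
  by move=> ak; have := A k; rewrite ak eqxx relm; case: ifP.
have [k [ak ask]] := cell_two d z.
by apply: (@miss_ge2 _ _ (s k) k); rewrite ?N ?ordS_neq.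
Qed.

Lemma opening_even : ~~ odd (free m).
Proof.
move: parity relm; case: ox => [x|] /= on H.
  have e : free m = n.-1.
    rewrite -[n in RHS]card_ord -(cardC1 x); apply: eq_card => k.
    by rewrite !inE H (inj_eq Some_inj); case: (k == x).
  by move: on; rewrite e; case: (n) n_ge4.
suff -> : free m = n by rewrite on.
by rewrite -[n in RHS]card_ord; apply: eq_card => k; rewrite !inE H.
Qed.

Lemma opening_has_move : has_move ends m.
Proof.
have [z hz] : exists z, forall x : 'I_n, ox = Some x -> al x != z.
  case: ox => [x|]; last by exists true.
  by exists (~~ al x) => _ [<-]; case: (al x).
have [k [ak _]] := cell_two d z.
have N l : al l = z -> rel m l = None.
  move=> al_l; rewrite relm; case: eqP => // /esym/hz.
  by rewrite al_l eqxx.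
apply/existsP; exists (Some k); apply/existsP; exists (false == al k).
apply: rmark_legal; first exact: N.
apply: valid_against => //; apply/forallP => l; apply/implyP => /eqP e.
by rewrite N // e.
Qed.

Lemma double_break k j j' : joint j -> joint j' -> j != j' -> al k = al j' ->
  rel m k = None -> valid (rmark m k false) ->
  ~~ has_cycle_cell cells (rmark m k false) ->
  k \in [:: p j'; j'] -> k \in [:: s j; s (s j)] -> wins ends cells (rmark m k false).
Proof.
move=> Jj Jj' ne ak rk V nc kj' kj; set m' := rmark m k false in V nc *.
have asj : al (s j) = al k by rewrite (joint_other d Jj Jj' ne).
(* On an arc of length 2 the arrow [k] leaves at most one gap. *)
have short : j' = s (s j) -> wins ends cells m'.
  move=> e; apply: (@near_wins (al k)) => //.
  have cell l : al l = al k -> l \in [:: s j; s (s j)].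
    by rewrite -asj; apply: arc2 => //; rewrite -e.
  have := V.2 (s j); rewrite (negbTE (joint_succ Jj)) => ok.
  apply/andP; split.
    have relk : rel m' k = Some false by rewrite rel_mark eqxx.
    apply/forallP => l; apply/implyP => /eqP/cell; move: kj; rewrite !inE.
    by case/orP => /eqP ek /orP[] /eqP ->; move: ok; rewrite -?ek relk //;
       case: (rel m' _) => [[]|].
  set o := if k == s j then s (s j) else s j.
  rewrite (leq_trans (subset_leq_card (_ : _ \subset pred1 o))) ?card1 //.
  apply/subsetP => l; rewrite [l \in _]inE /= rel_mark => /andP[/eqP/cell].
  case: (l =P k) => // nl lc _; rewrite inE /o; move: kj lc; rewrite !inE.
  case/orP=> /eqP ek /orP[] /eqP el; move: nl; rewrite ek el ?eqxx //.
  by rewrite (negbTE (ordS_neq _)).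
(* Either the arc has length 2, or the joints would be adjacent, or [k] is the middle of an arc of
   length 3. *)
move: (kj) (kj'); rewrite !inE => /orP[] /eqP ek /orP[] /eqP ek'.
- by apply: short; rewrite -ek ek' ord_predK.
- by have := joint_succ Jj; rewrite -ek ek' Jj'.
- have ej' : j' = s k by rewrite ek' ord_predK.
  have pk : p k = s j by rewrite ek ordSK.
  have Nk : ~~ joint k by rewrite ek'; exact: joint_pred.
  have Npk : ~~ joint (p k) by rewrite pk; exact: joint_succ.
  have cell l : al l = al k -> l \in [:: p k; k; s k].
    rewrite pk -asj ek => e; apply: arc3 e => //.
    by rewrite -ek -ej'.
  have rel' l : rel m' l = if l == k then Some false
      else if Some l == ox then Some true else None.
    by rewrite rel_mark relm.
  have n5 : 4 < n.
    by apply: (arc3_gt4 Jj); rewrite -ek -ej'.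
  (* For even [n] the edge opposite [k] is taken next; for odd [n], the mirror image of the first
     arrow [x]. *)
  move: parity relm rel'; case: ox => [x|] /= on relx rel'; last first.
    have [k0 [fk0 k0Y fixk]] := mirror_fix_even k (negbT on) n5.
    apply: (mirror_entry Nk Npk cell V k0Y) => // l.
    by rewrite rel' fk0; case: (l == k0).
  have {}relx : rel m' x = Some true.
    rewrite rel' eqxx; case: (x =P k) => // e; move: rk.
    by rewrite -e relx eqxx.
  have relk : rel m' k = Some false by rewrite rel' eqxx.
  (* On the short arc [x] would meet [k] with the opposite colour at a vertex off the chord. *)
  have xY : x \notin [:: p k; k; s k].
    have okp := V.2 (p k); have oks := V.2 k.
    rewrite !inE; apply/negP => /or3P[] /eqP e; move: relx; rewrite e.
    - by move=> r; move: okp; rewrite r ord_predK relk (negbTE Npk).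
    - by rewrite relk.
    - by move=> r; move: oks; rewrite r relk (negbTE Nk).
  have nx : mirror k x != x.
    by apply: contraNneq xY => /(mirror_fix_odd on)->; rewrite !inE eqxx orbT.
  apply: (mirror_entry Nk Npk cell V (k0 := mirror k x)).
  - by rewrite -(in_cell_y Nk Npk cell) (along_mirror Nk Npk cell) in_cell_y.
  - move=> l; rewrite rel' mirrorK (inj_eq Some_inj).
    by case: (l =P x) => [->|_]; rewrite // [x == mirror k x]eq_sym nx.
  - by move=> l /(mirror_fix_odd on); left.
- by apply: short; rewrite -ek -ek'.
Qed.

Lemma opening_loses : loses ends cells m.
Proof.
apply: loses_of_replies => //; first exact: opening_safe.
  exact: opening_has_move.
have ne : p a != p b by rewrite (inj_eq (@ord_pred_inj n)) ord_eqE; lia.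
have [Ja Jb] := (joint_pa, joint_pb).
move=> k c rk V nc.
have oddf : odd (free (rmark m k c)).
  by move: opening_even; rewrite (free_rmark c rk) /= negbK.
have wk j : joint j -> weak (rmark m k c) j.
  by move=> Jj; apply: good_weak => //; exact: opening_good.
have [Ga|/(broken Ja rk (opening_good _))[c0 Ba]] := boolP (good (rmark m k c) (p a)).
  exact: (good_weak_wins Ja Jb ne V oddf nc Ga (wk _ Jb)).
have [Gb|/(broken Jb rk (opening_good _))[_ Bb]] := boolP (good (rmark m k c) (p b)).
  by rewrite eq_sym in ne; apply: (good_weak_wins Jb Ja ne V oddf nc Gb (wk _ Ja)).
subst c; have nab : al (p a) = ~~ al (p b).
  by rewrite -(joint_other d Ja Jb ne) along_joint // negbK.
(* The edges just before the two joints lie in different cells, so [k] precedes one joint and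
   follows the other on the same arc. *)
move: Ba Bb; case: eqP => [e|/eqP e] Ba; case: eqP => [e'|/eqP e'] Bb.
- by move: nab; rewrite -e -e'; case: (al k).
- by rewrite eq_sym in ne; apply: (double_break Jb Ja ne).
- exact: (double_break Ja Jb ne).
- by move: e e'; rewrite nab; case: (al k); case: (al _).
Qed.

End Opening.

(** This answers an opponent who opens with the chord when [n] is odd: both ends are still open. *)
Lemma chord_only_wins m : m None = Some d -> (forall k, rel m k = None) -> odd n ->
  wins ends cells m.
Proof.
move=> md H on; have V : valid m by split=> // k; rewrite H.
have ne : p a != p b by rewrite (inj_eq (@ord_pred_inj n)) ord_eqE; lia.
apply: (good_weak_wins joint_pa joint_pb ne V).
- suff -> : free m = n by [].
  by rewrite -[n in RHS]card_ord; apply: eq_card => k; rewrite !inE H.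
- apply/cycle_cellP => // -[z F]; have [k [/F]] := cell_two d z.
  by rewrite H.
- by rewrite /good /can_left /can_right !H orbT.
- by rewrite /weak /can_left !H orbT.
Qed.

End ChordMarked.

(** * The first moves for each parity *)

Lemma even_player1_wins : ~~ odd n -> player1_wins ends cells.
Proof.
move=> evn; pose m1 := mark (empty_marking _) None true : position.
have r1 k : rel true m1 k = None by rewrite /rel !ffunE.
have V1 : valid true m1 by split=> [|k]; rewrite ?r1 ?ffunE.
apply: (@WinMove _ _ _ _ _ None true); first by apply: (valid_legal _ V1); rewrite ffunE.
by right; right; apply: (opening_loses (ox := None) V1) => //; apply/negbTE.
Qed.

Lemma odd_player2_wins : odd n -> player2_wins ends cells.
Proof.
move=> oddn; have nocell (m : position) : m None = None -> ~~ has_cycle_cell cells m.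
  by move=> mN; rewrite /has_cycle_cell /= /cycle_cell !all_rcons mN.
have V0 d : valid d (mark (empty_marking _) None d).
  by split=> [|k]; rewrite /rel ?ffunE.
apply: LoseAll.
  apply/existsP; exists None; apply/existsP; exists true.
  by apply: (valid_legal _ (V0 true)); rewrite ffunE.
move=> [x|] c L.
  set m1 := mark _ _ _.
  have m1N : m1 None = None by rewrite !ffunE.
  (* The chord is directed so that the opponent's first arrow runs along it. *)
  pose d := (a <= x < b) == c.
  have relm l : rel d (mark m1 None d) l = if Some l == Some x then Some true else None.
    rewrite /rel !ffunE /= (inj_eq Some_inj); case: eqP => [->|//] /=.
    by congr Some; rewrite /along /d; case: (c); case: (a <= x < b).
  have V : valid d (mark m1 None d).
    split=> [|k]; first by rewrite ffunE.
    rewrite !relm !(inj_eq Some_inj); case: (k =P x) => [->|//].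
    by rewrite (negbTE (ordS_neq x)).
  have W : wins ends cells m1.
    apply: (WinMove (valid_legal m1N V)); right; right.
    by apply: (opening_loses (ox := Some x) V relm).
  by split; [exact: nocell | exact: wins_has_move W | exact: W].
have W : wins ends cells (mark (empty_marking _) None c).
  by apply: (@chord_only_wins c) => // [|k]; rewrite /rel !ffunE.
split; [ | exact: wins_has_move W | exact: W].
apply/cycle_cellP; first by rewrite ffunE.
by move=> [z F]; have [k [/F]] := cell_two c z; rewrite /rel !ffunE.
Qed.

End ChordBoard.

Theorem theorem4p4 (n : nat) (a b : 'I_n) :
  4 <= n -> a.+1 < b -> ~~ ((nat_of_ord a == 0) && (nat_of_ord b == n.-1)) ->
  (~~ odd n -> player1_wins (chord_ends a b) (chord_cells a b)) /\
  (odd n -> player2_wins (chord_ends a b) (chord_cells a b)).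
Proof.
by move=> n4 ab nadj; split; [exact: even_player1_wins | exact: odd_player2_wins].
Qed.
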